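(* Let $[M]$ be a cloud with a nontrivial stabilizer and let $M$ be its center. Let $R$ be a correspondence between the clouds $[\Delta_1]$ and $[M]$ with finite distortion $\varepsilon=\operatorname{dis}R<\infty$. Then every space $Y\in R(\Delta_1)$ satisfies $|Y,M|\le 2\varepsilon$.
   Context: All metric spaces are non-empty. $|X,Y|$ denotes the Gromov--Hausdorff distance between metric spaces $X,Y$ (possibly $\infty$). $\mathcal{GH}_0$ is the class of all metric spaces, where two spaces are identified if their Gromov--Hausdorff distance is zero. The equivalence classes of the relation $X\sim Y\Leftrightarrow |X,Y|<\infty$ on $\mathcal{GH}_0$ are called clouds; $[X]$ is the cloud containing $X$. $\Delta_1$ is the one-point metric space, so $[\Delta_1]$ is the cloud of all bounded metric spaces. For a real $\lambda>0$, $\lambda X$ is the space $X$ with all distances multiplied by $\lambda$. The stabilizer of a cloud $[X]$ is the multiplicative subgroup $\operatorname{St}([X])=\{\lambda>0:[\lambda X]=[X]\}$ of the positive reals; it is trivial if it equals $\{1\}$, and nontrivial otherwise. The center of a cloud with nontrivial stabilizer is the (known to exist and be unique) element $M$ of the cloud, in $\mathcal{GH}_0$, such that $\lambda M=M$ in $\mathcal{GH}_0$ (i.e. $|\lambda M,M|=0$) for every $\lambda$ in the stabilizer. A correspondence $R$ between clouds $[X]$ and $[Y]$ is a surjective multivalued mapping from $[X]$ to $[Y]$, identified with its graph: a relation between elements of $[X]$ and elements of $[Y]$ such that every element of $[X]$ is related to at least one element of $[Y]$ and every element of $[Y]$ is related to at least one element of $[X]$. $R(A)$ is the class of all $B\in[Y]$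 related to $A\in[X]$. The distortion is $\operatorname{dis}R=\sup\{\,\big||A,A'|-|B,B'|\big|:(A,B),(A',B')\in R\}$. *)

(* Defs.v *)
From Stdlib Require Import Reals Lra.
From Coquelicot Require Import Coquelicot.
Open Scope R_scope.

Record MetSpace : Type := mkMetSpace {
  space :> Metric_Space;
  space_inhabited : inhabited (Base space)
}.

Definition one_point_metric : Metric_Space.
Proof.
refine {| Base := unit; dist := fun _ _ => 0 |}.
- intros; lra.
- reflexivity.
- intros [] []; split; reflexivity.
- intros; lra.
Defined.

Definition Delta1 : MetSpace := mkMetSpace one_point_metric (inhabits tt).

Definition scale_metric (l : posreal) (X : Metric_Space) : Metric_Space.
Proof.
refine {| Base := Base X; dist := fun x y => l * dist X x y |}.
- intros x y; pose proof (cond_pos l); pose proof (dist_pos X x y); nra.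
- intros x y; rewrite dist_sym; reflexivity.
- intros x y; pose proof (cond_pos l); rewrite <- (dist_refl X); split.
  + intros H'; apply Rmult_integral in H'; lra.
  + intros ->; ring.
- intros x y z; pose proof (cond_pos l); pose proof (dist_tri X x y z); nra.
Defined.

Definition scale (l : posreal) (X : MetSpace) : MetSpace :=
  mkMetSpace (scale_metric l X) (space_inhabited X).

Definition nbhd (Z : Metric_Space) (r : R) (A : Base Z -> Prop) : Base Z -> Prop :=
  fun z => exists a, A a /\ dist Z a z < r.

Definition Hausdorff_dist (Z : Metric_Space) (A B : Base Z -> Prop) : Rbar :=
  Glb_Rbar (fun r => 0 < r /\
    (forall a, A a -> nbhd Z r B a) /\ (forall b, B b -> nbhd Z r A b)).

Definition isometric_embedding (X Z : Metric_Space) (f : Base X -> Base Z) : Prop :=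
  forall x y, dist Z (f x) (f y) = dist X x y.

Definition image {S T : Type} (f : S -> T) : T -> Prop :=
  fun t => exists s, f s = t.

(* |X, Y|: infimum of the Hausdorff distances between isometric copies of X
   and Y inside a common metric space Z. *)
Definition GH_dist (X Y : MetSpace) : Rbar :=
  Rbar_glb (fun d =>
    exists (Z : Metric_Space) (f : Base X -> Base Z) (g : Base Y -> Base Z),
      isometric_embedding X Z f /\ isometric_embedding Y Z g /\
      d = Hausdorff_dist Z (image f) (image g)).

(* Equality in the class GH_0. GH_0 is handled as a setoid: its elements are
   given by representatives X : MetSpace up to GH_eq. *)
Definition GH_eq (X Y : MetSpace) : Prop := GH_dist X Y = Finite 0.

Definition cloud (X : MetSpace) : MetSpace -> Prop :=
  fun Y => Rbar_lt (GH_dist X Y) p_infty.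

Definition cloud_eq (X Y : MetSpace) : Prop :=
  forall Z : MetSpace, cloud X Z <-> cloud Y Z.

Definition stabilizer (X : MetSpace) : posreal -> Prop :=
  fun l => cloud_eq (scale l X) X.

Definition trivial_stabilizer (X : MetSpace) : Prop :=
  forall l : posreal, stabilizer X l <-> pos l = 1.

Definition is_center (X M : MetSpace) : Prop :=
  cloud X M /\ forall l : posreal, stabilizer X l -> GH_eq (scale l M) M.

(* corr_eq says that the relation descends to the quotient GH_0. *)
Record correspondence (X Y : MetSpace) (Rel : MetSpace -> MetSpace -> Prop) : Prop := {
  corr_cloud : forall A B, Rel A B -> cloud X A /\ cloud Y B;
  corr_eq : forall A A' B B', GH_eq A A' -> GH_eq B B' -> Rel A B -> Rel A' B';
  corr_total : forall A, cloud X A -> exists B, Rel A B;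
  corr_surj : forall B, cloud Y B -> exists A, Rel A B
}.

(* For related pairs of a correspondence both distances below are finite, so
   Rbar_minus is the ordinary subtraction. *)
Definition distortion (Rel : MetSpace -> MetSpace -> Prop) : Rbar :=
  Rbar_lub (fun d => exists A A' B B', Rel A B /\ Rel A' B' /\
    d = Rbar_abs (Rbar_minus (GH_dist A A') (GH_dist B B'))).

(* Main.v *)
Require Import Defs.
From Stdlib Require Import Reals Lra Classical.
From Coquelicot Require Import Coquelicot.
Open Scope R_scope.

(** In the cloud of bounded spaces [Delta1] is an end point: two spaces are never
    further apart than the larger of their distances to [Delta1], so a
    correspondence of distortion [eps] gives
    [|B, B'| <= max (|B, Y|, |B', Y|) + 2 eps] in the cloud of [M] for
    [Y] related to [Delta1].  On the other hand every bounded [A] lies halfway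
    between [Delta1] and [2 A].  Transporting this to the pair [Y], [t Y] and
    rescaling by [1/t], where [t M = M], makes the additive errors and the distance
    from [Y/t] to [M] as small as we like: with [d = |Y, M|] there is [B'] with
    [|B', M|] close to [2 d] and [|B', Y|] close to [d].  Comparing the two facts
    for [B = M] yields [2 d <= d + 2 eps]. *)

Lemma Rabs_le_iff (x a : R) : Rabs x <= a <-> - a <= x <= a.
Proof. split; [apply Rabs_le_between | apply Rabs_le]. Qed.

Lemma Rbar_glb_correct (E : Rbar -> Prop) : Rbar_is_glb E (Rbar_glb E).
Proof. exact (proj2_sig (Rbar_ex_glb E)). Qed.

Lemma Rbar_lub_correct (E : Rbar -> Prop) : Rbar_is_lub E (Rbar_lub E).
Proof. exact (proj2_sig (Rbar_ex_lub E)). Qed.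

(** * Gromov-Hausdorff distance through correspondences of points *)

Definition close_rel (X Y : Metric_Space) (r : R) (S : Base X -> Base Y -> Prop) : Prop :=
  (forall x, exists y, S x y) /\ (forall y, exists x, S x y) /\
  forall x x' y y', S x y -> S x' y' -> Rabs (dist X x x' - dist Y y y') <= 2 * r.

(** The classical reformulation of |X, Y| as half the least distortion of a relation between points.
    The bound 2 r in [close_rel] absorbs the half, so that radii add under composition and scale
    linearly. *)
Definition close (X Y : Metric_Space) (r : R) : Prop := exists S, close_rel X Y r S.

Lemma close_sym (X Y : Metric_Space) (r : R) : close X Y r -> close Y X r.
Proof.
intros [S [HX [HY H]]]; exists (fun y x => S x y); repeat split; auto.
intros; rewrite Rabs_minus_sym; auto.
Qed.

Lemma close_trans (X Y Z : Metric_Space) (r s : R) :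
  close X Y r -> close Y Z s -> close X Z (r + s).
Proof.
intros [S [SX [SY HS]]] [T [TY [TZ HT]]].
exists (fun x z => exists y, S x y /\ T y z); repeat split.
- intros x; destruct (SX x) as [y ?], (TY y) as [z ?]; eauto.
- intros z; destruct (TZ z) as [y ?], (SY y) as [x ?]; eauto.
- intros x x' z z' [y [? ?]] [y' [? ?]].
  assert (hS : Rabs (dist X x x' - dist Y y y') <= 2 * r) by auto.
  assert (hT : Rabs (dist Y y y' - dist Z z z') <= 2 * s) by auto.
  apply Rabs_le_iff in hS, hT; apply Rabs_le_iff; lra.
Qed.

Lemma close_scale (l : posreal) (X Y : Metric_Space) (r : R) :
  close X Y r -> close (scale_metric l X) (scale_metric l Y) (l * r).
Proof.
intros [S [HX [HY H]]]; exists S; repeat split; auto.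
intros x x' y y' h h'; specialize (H x x' y y' h h'); simpl.
pose proof (cond_pos l).
rewrite <- Rmult_minus_distr_l, Rabs_mult, (Rabs_pos_eq l) by lra; nra.
Qed.

Lemma close_isometry (X Y : Metric_Space) (f : Base X -> Base Y) :
  (forall y, exists x, f x = y) -> isometric_embedding X Y f -> close X Y 0.
Proof.
intros surj iso; exists (fun x y => f x = y); repeat split; eauto.
intros x x' y y' <- <-; rewrite iso, Rminus_diag, Rabs_R0; lra.
Qed.

Lemma close_scale_mul (a b c : posreal) (X : Metric_Space) :
  pos c = a * b -> close (scale_metric c X) (scale_metric a (scale_metric b X)) 0.
Proof.
intros e.
apply (close_isometry (scale_metric c X) (scale_metric a (scale_metric b X)) (fun x => x)).
- eauto.
- intros x y; simpl; rewrite e; ring.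
Qed.

Lemma close_scale_1 (c : posreal) (X : Metric_Space) :
  pos c = 1 -> close (scale_metric c X) X 0.
Proof.
intros e; apply (close_isometry (scale_metric c X) X (fun x => x)).
- eauto.
- intros x y; simpl; rewrite e; ring.
Qed.

(** All points of A are related to the single point, so the distortion bound compares each distance
    in A with 0. *)
Lemma close_one_point_diam (A : Metric_Space) (r : R) :
  close A one_point_metric r -> forall a a', dist A a a' <= 2 * r.
Proof.
intros [S [HA [_ H]]] a a'.
destruct (HA a) as [u hu], (HA a') as [v hv].
specialize (H _ _ _ _ hu hv); simpl in H; apply Rabs_le_iff in H; lra.
Qed.

(** The full relation works: all distances on both sides lie in [0, 2 r], hence differ by at most 2
    r. *)
Lemma close_of_diam (A B : MetSpace) (r : R) :
  (forall a a', dist A a a' <= 2 * r) -> (forall b b', dist B b b' <= 2 * r) ->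
  close A B r.
Proof.
intros hA hB; destruct (space_inhabited A) as [a], (space_inhabited B) as [b].
exists (fun _ _ => True); repeat split; eauto.
intros x x' y y' _ _; pose proof (hA x x'); pose proof (hB y y').
pose proof (dist_pos A x x'); pose proof (dist_pos B y y').
apply Rabs_le_iff; lra.
Qed.

Lemma close_scale_2_diam (t : posreal) (A : Metric_Space) (r : R) : pos t = 2 ->
  (forall a a', dist A a a' <= 2 * r) -> close (scale_metric t A) A r.
Proof.
intros e hA; exists (fun x y : Base A => x = y); repeat split; eauto.
intros x x' y y' -> ->; simpl; rewrite e; pose proof (hA y y').
pose proof (dist_pos A y y'); apply Rabs_le_iff; lra.
Qed.

(** * Gluing two spaces along a relation of small distortion *)

Section Glue.

Variables (X Y : MetSpace) (S : Base X -> Base Y -> Prop) (r : R).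
Hypothesis r_pos : 0 < r.
Hypothesis S_close : close_rel X Y r S.

(** The distance across the disjoint union: the cheapest path from x to y when each related pair is
    joined by a bridge of length r. Since r > 0, no point of X gets identified with a point of Y, so
    the result is a metric and not just a pseudometric. *)
Definition glue_cross (x : Base X) (y : Base Y) : R :=
  real (Glb_Rbar (fun v => exists x' y', S x' y' /\ v = dist X x x' + r + dist Y y' y)).

Lemma glue_cross_glb x y :
  (forall x' y', S x' y' -> glue_cross x y <= dist X x x' + r + dist Y y' y) /\
  (forall c, (forall x' y', S x' y' -> c <= dist X x x' + r + dist Y y' y) ->
    c <= glue_cross x y).
Proof.
unfold glue_cross.
set (E := fun v => exists x' y', S x' y' /\ v = dist X x x' + r + dist Y y' y).
destruct (Glb_Rbar_correct E) as [lb glb].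
(* [real] would send an infinite infimum to 0. Here the infimum is finite: 0 is a lower bound, and
   totality of S at x provides an element. *)
assert (fin : is_finite (Glb_Rbar E)).
{ destruct S_close as [HX _]; destruct (HX x) as [y' h].
  apply is_finite_correct.
  assert (h1 := lb _ (ex_intro _ x (ex_intro _ y' (conj h eq_refl)))).
  assert (h0 : Rbar_le (Finite 0) (Glb_Rbar E)).
  { apply glb; intros v [x1 [y1 [_ ->]]]; simpl.
    pose proof (dist_pos X x x1); pose proof (dist_pos Y y1 y); lra. }
  destruct (Glb_Rbar E) as [g| |]; simpl in *; [eauto | tauto | tauto]. }
rewrite <- fin in lb, glb; split.
- intros x' y' h; apply lb; red; eauto.
- intros c h; apply (glb (Finite c)); intros v [x' [y' [h' ->]]]; simpl; auto.
Qed.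

Lemma glue_cross_ge x y : r <= glue_cross x y.
Proof.
apply glue_cross_glb; intros x' y' _.
pose proof (dist_pos X x x'); pose proof (dist_pos Y y' y); lra.
Qed.

Lemma glue_cross_rel x y : S x y -> glue_cross x y <= r.
Proof.
intros h; destruct (glue_cross_glb x y) as [lb _]; specialize (lb _ _ h).
rewrite (proj2 (dist_refl X x x)), (proj2 (dist_refl Y y y)) in lb by reflexivity; lra.
Qed.

Lemma glue_cross_tri_l x x' y : glue_cross x y <= dist X x x' + glue_cross x' y.
Proof.
enough (glue_cross x y - dist X x x' <= glue_cross x' y) by lra.
apply glue_cross_glb; intros x1 y1 h.
pose proof (proj1 (glue_cross_glb x y) _ _ h); pose proof (dist_tri X x x1 x'); lra.
Qed.

Lemma glue_cross_tri_r x y y' : glue_cross x y <= glue_cross x y' + dist Y y' y.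
Proof.
enough (glue_cross x y - dist Y y' y <= glue_cross x y') by lra.
apply glue_cross_glb; intros x1 y1 h.
pose proof (proj1 (glue_cross_glb x y) _ _ h); pose proof (dist_tri Y y1 y y'); lra.
Qed.

(** A path from x to x' through y crosses two bridges, of total length 2 r. This pays exactly for
    replacing the distance of y1, y2 by that of x1, x2, which is where the distortion bound on S
    enters. [glue_cross_tri_Y] is the mirror image. *)
Lemma glue_cross_tri_X x x' y : dist X x x' <= glue_cross x y + glue_cross x' y.
Proof.
enough (dist X x x' - glue_cross x' y <= glue_cross x y) by lra.
apply glue_cross_glb; intros x1 y1 h1.
enough (dist X x x' - (dist X x x1 + r + dist Y y1 y) <= glue_cross x' y) by lra.
apply glue_cross_glb; intros x2 y2 h2.
pose proof (proj2 (proj2 S_close) _ _ _ _ h1 h2) as H; apply Rabs_le_iff in H.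
pose proof (dist_tri X x x' x1); pose proof (dist_tri X x1 x' x2).
rewrite (dist_sym X x' x2) in *; pose proof (dist_tri Y y1 y2 y).
rewrite (dist_sym Y y y2) in *; lra.
Qed.

Lemma glue_cross_tri_Y x y y' : dist Y y y' <= glue_cross x y + glue_cross x y'.
Proof.
enough (dist Y y y' - glue_cross x y' <= glue_cross x y) by lra.
apply glue_cross_glb; intros x1 y1 h1.
enough (dist Y y y' - (dist X x x1 + r + dist Y y1 y) <= glue_cross x y') by lra.
apply glue_cross_glb; intros x2 y2 h2.
pose proof (proj2 (proj2 S_close) _ _ _ _ h1 h2) as H; apply Rabs_le_iff in H.
pose proof (dist_tri Y y y' y1); pose proof (dist_tri Y y1 y' y2).
rewrite (dist_sym Y y y1) in *; pose proof (dist_tri X x1 x2 x).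
rewrite (dist_sym X x1 x) in *; lra.
Qed.

Definition glue_dist (u v : Base X + Base Y) : R :=
  match u, v with
  | inl x, inl x' => dist X x x'
  | inr y, inr y' => dist Y y y'
  | inl x, inr y => glue_cross x y
  | inr y, inl x => glue_cross x y
  end.

Definition glue : Metric_Space.
Proof.
refine {| Base := (Base X + Base Y)%type; dist := glue_dist |}.
- intros [x|y] [x'|y']; simpl; try apply dist_pos;
    apply Rle_ge; eapply Rle_trans; [| apply glue_cross_ge | | apply glue_cross_ge]; lra.
- intros [x|y] [x'|y']; simpl; try apply dist_sym; reflexivity.
- intros [x|y] [x'|y']; simpl.
  + rewrite dist_refl; split; congruence.
  + pose proof (glue_cross_ge x y'); split; [lra | discriminate].
  + pose proof (glue_cross_ge x' y); split; [lra | discriminate].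
  + rewrite dist_refl; split; congruence.
- intros [x|y] [x'|y'] [x''|y'']; simpl.
  + apply dist_tri.
  + apply glue_cross_tri_X.
  + apply glue_cross_tri_l.
  + apply glue_cross_tri_r.
  + rewrite dist_sym, Rplus_comm, dist_sym, (dist_sym X x''); apply glue_cross_tri_l.
  + rewrite (dist_sym Y y y''), Rplus_comm; apply glue_cross_tri_r.
  + apply glue_cross_tri_Y.
  + apply dist_tri.
Defined.

Lemma GH_dist_le_glue : Rbar_le (GH_dist X Y) (Finite r).
Proof.
apply Rbar_le_trans with (Hausdorff_dist glue (image (@inl (Base X) (Base Y)))
                                              (image (@inr (Base X) (Base Y)))).
- unfold GH_dist; apply Rbar_glb_correct.
  exists glue, inl, inr; repeat split.
(* [nbhd] is defined by a strict inequality, while related points may be at distance exactly r; the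
   slack e is removed at the end. *)
- assert (H : forall e, 0 < e -> Rbar_le (Hausdorff_dist glue
     (image (@inl (Base X) (Base Y))) (image (@inr (Base X) (Base Y)))) (Finite (r + e))).
  { intros e e_pos; unfold Hausdorff_dist.
    apply Glb_Rbar_correct; repeat split; [lra | |].
    - intros _ [x <-]; destruct (proj1 S_close x) as [y h].
      exists (inr y); split; [exists y; reflexivity |]; simpl.
      pose proof (glue_cross_rel _ _ h); lra.
    - intros _ [y <-]; destruct (proj1 (proj2 S_close) y) as [x h].
      exists (inl x); split; [exists x; reflexivity |]; simpl.
      pose proof (glue_cross_rel _ _ h); lra. }
  destruct (Hausdorff_dist _ _ _) as [h| |]; simpl in *.
  + apply le_epsilon; auto.
  + exact (H 1 Rlt_0_1).
  + exact I.
Qed.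

End Glue.

(** * From common ambient spaces to relations of points and back *)

Lemma GH_dist_le_close (X Y : MetSpace) (r : R) :
  0 < r -> close X Y r -> Rbar_le (GH_dist X Y) (Finite r).
Proof. intros r_pos [S h]; exact (GH_dist_le_glue X Y S r r_pos h). Qed.

(** Admissible radii are closed upwards, so if r were not admissible it would be a lower bound of
    them all. *)
Lemma Hausdorff_dist_lt (Z : Metric_Space) (A B : Base Z -> Prop) (r : R) :
  Rbar_lt (Hausdorff_dist Z A B) (Finite r) ->
  (forall a, A a -> nbhd Z r B a) /\ (forall b, B b -> nbhd Z r A b).
Proof.
intros lt; apply NNPP; intros no.
apply (Rbar_lt_not_le _ _ lt), Glb_Rbar_correct.
intros s [_ [hA hB]]; apply Rnot_lt_le; intros lt_sr; apply no; split.
- intros a ha; destruct (hA a ha) as [b [? ?]]; exists b; split; [assumption | lra].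
- intros b hb; destruct (hB b hb) as [a [? ?]]; exists a; split; [assumption | lra].
Qed.

(** In an ambient space where the Hausdorff distance is below r, relate the points whose images are
    less than r apart. Passing from one pair to a related one moves each end by less than r, so
    distances change by less than 2 r. *)
Lemma close_of_GH_dist_lt (X Y : MetSpace) (r : R) :
  Rbar_lt (GH_dist X Y) (Finite r) -> close X Y r.
Proof.
intros lt; apply NNPP; intros no.
apply (Rbar_lt_not_le _ _ lt), Rbar_glb_correct.
intros d [Z [f [g [iso_f [iso_g ->]]]]].
apply Rbar_not_lt_le; intros lt_r; apply no.
destruct (Hausdorff_dist_lt _ _ _ _ lt_r) as [hX hY].
exists (fun x y => dist Z (f x) (g y) < r); repeat split.
- intros x; destruct (hX (f x)) as [_ [[y <-] ?]]; [exists x; reflexivity |].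
  exists y; rewrite dist_sym; assumption.
- intros y; destruct (hY (g y)) as [_ [[x <-] ?]]; [exists y; reflexivity |].
  exists x; assumption.
- intros x x' y y' h h'; rewrite <- (iso_f x x'), <- (iso_g y y').
  pose proof (dist_tri Z (f x) (f x') (g y)); pose proof (dist_tri Z (g y) (f x') (g y')).
  pose proof (dist_tri Z (g y) (g y') (f x)); pose proof (dist_tri Z (f x) (g y') (f x')).
  rewrite (dist_sym Z (g y') (f x')), (dist_sym Z (g y) (f x)) in *.
  apply Rabs_le_iff; lra.
Qed.

Lemma GH_dist_pos (X Y : MetSpace) : Rbar_le (Finite 0) (GH_dist X Y).
Proof.
apply Rbar_glb_correct; intros d [Z [f [g [_ [_ ->]]]]].
apply Glb_Rbar_correct; intros s [h _]; simpl; lra.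
Qed.

(** The infimum need not be attained, hence the quantification over s > r. The metric properties and
    the estimates below go through this criterion instead of ambient spaces. *)
Lemma GH_dist_le_iff (X Y : MetSpace) (r : R) :
  Rbar_le (GH_dist X Y) (Finite r) <-> 0 <= r /\ forall s, r < s -> close X Y s.
Proof.
pose proof (GH_dist_pos X Y) as pos; split.
- intros le; split; [exact (Rbar_le_trans _ _ _ pos le) |].
  intros s lt; apply close_of_GH_dist_lt; exact (Rbar_le_lt_trans _ (Finite r) (Finite s) le lt).
- intros [r_pos H].
  assert (H' : forall e, 0 < e -> Rbar_le (GH_dist X Y) (Finite (r + e))).
  { intros e e_pos; apply GH_dist_le_close; [lra | apply H; lra]. }
  destruct (GH_dist X Y) as [d| |]; simpl in *.
  + apply le_epsilon; auto.
  + exact (H' 1 Rlt_0_1).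
  + exact I.
Qed.

Lemma GH_dist_le_of_close_0 (X Y : MetSpace) :
  close X Y 0 -> Rbar_le (GH_dist X Y) (Finite 0).
Proof.
intros [S [HX [HY H]]]; apply GH_dist_le_iff; split; [lra |].
intros s lt; exists S; repeat split; auto.
intros x x' y y' h h'; specialize (H _ _ _ _ h h'); lra.
Qed.

(** * Symmetry, triangle inequality, scaling and real-valued distances *)

Lemma GH_dist_sym (X Y : MetSpace) : GH_dist X Y = GH_dist Y X.
Proof.
assert (H : forall X Y, Rbar_le (GH_dist X Y) (GH_dist Y X)).
{ clear; intros X Y; pose proof (GH_dist_pos Y X).
  destruct (GH_dist Y X) as [d| |] eqn:e; [| destruct (GH_dist X Y); exact I | tauto].
  assert (le : Rbar_le (GH_dist Y X) (Finite d)) by (rewrite e; apply Rbar_le_refl).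
  apply GH_dist_le_iff in le; apply GH_dist_le_iff; destruct le; split; auto.
  intros; apply close_sym; auto. }
apply Rbar_le_antisym; apply H.
Qed.

Lemma GH_dist_tri (X Y Z : MetSpace) (a b : R) :
  Rbar_le (GH_dist X Y) (Finite a) -> Rbar_le (GH_dist Y Z) (Finite b) ->
  Rbar_le (GH_dist X Z) (Finite (a + b)).
Proof.
rewrite !GH_dist_le_iff; intros [? ha] [? hb]; split; [lra |].
intros s lt; replace s with ((a + (s - a - b) / 2) + (b + (s - a - b) / 2)) by field.
apply close_trans with Y; [apply ha | apply hb]; lra.
Qed.

Lemma GH_dist_scale_le (l : posreal) (X Y : MetSpace) (a : R) :
  Rbar_le (GH_dist X Y) (Finite a) ->
  Rbar_le (GH_dist (scale l X) (scale l Y)) (Finite (l * a)).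
Proof.
pose proof (cond_pos l).
rewrite !GH_dist_le_iff; intros [? ha]; split; [nra |].
intros s lt; replace s with (l * (s / l)) by (field; lra).
apply close_scale, ha; apply Rmult_lt_reg_l with l; [lra |].
replace (l * (s / l)) with s by (field; lra); exact lt.
Qed.

Lemma GH_dist_scale_mul (a b c : posreal) (X : MetSpace) : pos c = a * b ->
  Rbar_le (GH_dist (scale c X) (scale a (scale b X))) (Finite 0).
Proof. intros e; apply GH_dist_le_of_close_0, close_scale_mul, e. Qed.

Lemma GH_dist_scale_1 (c : posreal) (X : MetSpace) : pos c = 1 ->
  Rbar_le (GH_dist (scale c X) X) (Finite 0).
Proof. intros e; apply GH_dist_le_of_close_0, close_scale_1, e. Qed.

Definition posreal_inv (l : posreal) : posreal :=
  mkposreal (/ l) (Rinv_0_lt_compat _ (cond_pos l)).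

Definition posreal_mul (a b : posreal) : posreal :=
  mkposreal (a * b) (Rmult_lt_0_compat _ _ (cond_pos a) (cond_pos b)).

Lemma GH_dist_scale_inv (l : posreal) (X : MetSpace) :
  Rbar_le (GH_dist X (scale (posreal_inv l) (scale l X))) (Finite 0).
Proof.
pose proof (cond_pos l).
rewrite <- (Rplus_0_r 0); apply GH_dist_tri with (scale (mkposreal 1 Rlt_0_1) X).
- rewrite GH_dist_sym; apply GH_dist_scale_1; reflexivity.
- apply GH_dist_scale_mul; simpl; field; lra.
Qed.

(** Real values make linear arithmetic available. An infinite distance would become 0, so the value
    is meaningful only within one cloud, where [cloud_finite] applies. *)
Definition GH_real (X Y : MetSpace) : R := real (GH_dist X Y).

Lemma GH_real_correct (X Y : MetSpace) (a : R) :
  Rbar_le (GH_dist X Y) (Finite a) ->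
  GH_dist X Y = Finite (GH_real X Y) /\ 0 <= GH_real X Y <= a.
Proof.
pose proof (GH_dist_pos X Y); unfold GH_real.
destruct (GH_dist X Y); simpl in *; tauto.
Qed.

Lemma cloud_GH_dist (X Y : MetSpace) : cloud X Y ->
  GH_dist X Y = Finite (GH_real X Y).
Proof.
unfold cloud, GH_real; pose proof (GH_dist_pos X Y).
destruct (GH_dist X Y); simpl in *; tauto.
Qed.

Lemma cloud_of_GH_dist_le (X Y : MetSpace) (a : R) :
  Rbar_le (GH_dist X Y) (Finite a) -> cloud X Y.
Proof. intros h; exact (Rbar_le_lt_trans _ (Finite a) p_infty h I). Qed.

Lemma cloud_finite (X A B : MetSpace) : cloud X A -> cloud X B ->
  GH_dist A B = Finite (GH_real A B).
Proof.
intros hA hB; apply cloud_GH_dist in hA, hB.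
apply (GH_real_correct A B (GH_real X A + GH_real X B)), GH_dist_tri with X.
- rewrite GH_dist_sym, hA; apply Rbar_le_refl.
- rewrite hB; apply Rbar_le_refl.
Qed.

Lemma GH_real_sym (X Y : MetSpace) : GH_real X Y = GH_real Y X.
Proof. unfold GH_real; rewrite GH_dist_sym; reflexivity. Qed.

Lemma GH_real_le (X Y : MetSpace) (a : R) :
  Rbar_le (GH_dist X Y) (Finite a) -> GH_real X Y <= a.
Proof. intros h; apply GH_real_correct, h. Qed.

Lemma GH_real_tri (X A B C : MetSpace) : cloud X A -> cloud X B -> cloud X C ->
  GH_real A C <= GH_real A B + GH_real B C.
Proof.
intros hA hB hC; apply GH_real_le, GH_dist_tri with B.
- rewrite (cloud_finite X A B) by assumption; apply Rbar_le_refl.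
- rewrite (cloud_finite X B C) by assumption; apply Rbar_le_refl.
Qed.

Lemma GH_dist_unscale_le (l : posreal) (X Y : MetSpace) (r : R) :
  Rbar_le (GH_dist (scale l X) (scale l Y)) (Finite r) ->
  Rbar_le (GH_dist X Y) (Finite (r / l)).
Proof.
intros h; pose proof (cond_pos l); apply (GH_dist_scale_le (posreal_inv l)) in h; simpl in h.
replace (r / l) with (0 + (/ l * r + 0)) by (field; lra).
eapply GH_dist_tri; [apply (GH_dist_scale_inv l) |].
eapply GH_dist_tri; [exact h | rewrite GH_dist_sym; apply GH_dist_scale_inv].
Qed.

Lemma GH_real_scale (l : posreal) (X Y : MetSpace) : cloud X Y ->
  GH_real (scale l X) (scale l Y) = l * GH_real X Y.
Proof.
intros h; pose proof (cond_pos l).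
assert (le : Rbar_le (GH_dist (scale l X) (scale l Y)) (Finite (l * GH_real X Y))).
{ apply GH_dist_scale_le; rewrite (cloud_GH_dist _ _ h); apply Rbar_le_refl. }
apply Rle_antisym; [apply GH_real_le, le |].
assert (ge : GH_real X Y <= GH_real (scale l X) (scale l Y) / l).
{ apply GH_real_le, GH_dist_unscale_le; destruct (GH_real_correct _ _ _ le) as [-> _].
  apply Rbar_le_refl. }
apply (Rmult_le_compat_l l) in ge; [| lra].
replace (l * (GH_real (scale l X) (scale l Y) / l))
  with (GH_real (scale l X) (scale l Y)) in ge by (field; lra).
exact ge.
Qed.

(** As Z and l Z are at distance zero, |l A, Z| = |l A, l Z|. It serves both clouds: with Z =
    [Delta1] for doubling, and with Z = M for the scalings by t and 1/t. *)
Lemma GH_real_scale_fixed (l : posreal) (Z A : MetSpace) : cloud Z A ->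
  Rbar_le (GH_dist (scale l Z) Z) (Finite 0) ->
  cloud Z (scale l A) /\ GH_real (scale l A) Z = l * GH_real A Z.
Proof.
intros hA fixed.
assert (hA' : cloud Z (scale l A)).
{ apply cloud_of_GH_dist_le with (0 + l * GH_real Z A).
  apply GH_dist_tri with (scale l Z); [rewrite GH_dist_sym; exact fixed |].
  apply GH_dist_scale_le; rewrite (cloud_GH_dist _ _ hA); apply Rbar_le_refl. }
assert (hZ : cloud Z (scale l Z)).
{ unfold cloud; rewrite GH_dist_sym; exact (cloud_of_GH_dist_le _ _ _ fixed). }
assert (hZZ : cloud Z Z).
{ apply cloud_of_GH_dist_le with (0 + 0), GH_dist_tri with (scale l Z);
    [rewrite GH_dist_sym |]; exact fixed. }
split; [exact hA' |]; apply GH_real_le in fixed.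
rewrite (GH_real_sym A Z), <- GH_real_scale, (GH_real_sym (scale l A)) by exact hA.
pose proof (GH_real_tri Z _ _ _ hZZ hZ hA'); pose proof (GH_real_tri Z _ _ _ hZ hZZ hA').
rewrite (GH_real_sym Z (scale l Z)) in *; lra.
Qed.

(** * The cloud of bounded spaces *)

(** The distance to [Delta1] is half the diameter, so both diameters are controlled and the full
    relation applies. *)
Lemma GH_dist_bounded_max (A B : MetSpace) (r : R) :
  Rbar_le (GH_dist A Delta1) (Finite r) -> Rbar_le (GH_dist B Delta1) (Finite r) ->
  Rbar_le (GH_dist A B) (Finite r).
Proof.
rewrite !GH_dist_le_iff; intros [? hA] [_ hB]; split; [assumption |].
intros s lt; apply close_of_diam; apply close_one_point_diam; auto.
Qed.

(** Under the identity relation, doubling changes each distance by itself, hence by at most the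
    diameter. *)
Lemma GH_dist_scale_2_bounded (t : posreal) (A : MetSpace) (r : R) : pos t = 2 ->
  Rbar_le (GH_dist A Delta1) (Finite r) -> Rbar_le (GH_dist (scale t A) A) (Finite r).
Proof.
rewrite !GH_dist_le_iff; intros e [? hA]; split; [assumption |].
intros s lt; apply close_scale_2_diam; [exact e |]; apply close_one_point_diam; auto.
Qed.

Lemma GH_dist_scale_Delta1 (t : posreal) :
  Rbar_le (GH_dist (scale t Delta1) Delta1) (Finite 0).
Proof.
apply GH_dist_le_of_close_0.
apply (close_isometry (scale_metric t one_point_metric) one_point_metric (fun x => x)).
- eauto.
- intros x y; simpl; ring.
Qed.

(** * Scalings fixing the center *)

Lemma GH_fixed_mul (M : MetSpace) (a b : posreal) :
  Rbar_le (GH_dist (scale a M) M) (Finite 0) ->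
  Rbar_le (GH_dist (scale b M) M) (Finite 0) ->
  Rbar_le (GH_dist (scale (posreal_mul a b) M) M) (Finite 0).
Proof.
intros ha hb; replace 0 with (0 + (a * 0 + 0)) by ring.
eapply GH_dist_tri; [apply (GH_dist_scale_mul a b); reflexivity |].
eapply GH_dist_tri; [apply GH_dist_scale_le, hb | exact ha].
Qed.

Lemma GH_fixed_inv (M : MetSpace) (a : posreal) :
  Rbar_le (GH_dist (scale a M) M) (Finite 0) ->
  Rbar_le (GH_dist (scale (posreal_inv a) M) M) (Finite 0).
Proof.
intros ha; rewrite GH_dist_sym; replace 0 with (0 + posreal_inv a * 0) by ring.
eapply GH_dist_tri; [apply (GH_dist_scale_inv a) |].
apply GH_dist_scale_le, ha.
Qed.

Lemma GH_fixed_pow (M : MetSpace) (a : posreal) (n : nat) :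
  Rbar_le (GH_dist (scale a M) M) (Finite 0) ->
  exists t : posreal, pos t = a ^ n /\ Rbar_le (GH_dist (scale t M) M) (Finite 0).
Proof.
intros ha; induction n as [|n [t [e ht]]].
- exists (mkposreal 1 Rlt_0_1); split; [reflexivity | apply GH_dist_scale_1; reflexivity].
- exists (posreal_mul a t); split; [simpl; rewrite e; reflexivity | apply GH_fixed_mul; assumption].
Qed.

Lemma stabilizer_1 (M : MetSpace) (l : posreal) : pos l = 1 -> stabilizer M l.
Proof.
intros e; pose proof (GH_dist_scale_1 l M e) as h.
intros Z; split; intros c; pose proof (cloud_GH_dist _ _ c) as fin;
  eapply cloud_of_GH_dist_le.
- eapply GH_dist_tri; [rewrite GH_dist_sym; exact h | rewrite fin; apply Rbar_le_refl].
- eapply GH_dist_tri; [exact h | rewrite fin; apply Rbar_le_refl].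
Qed.

(** A stabilizer element other than 1, or its inverse, exceeds 1; its powers fix M and are
    unbounded. *)
Lemma center_fixed_large (M : MetSpace) (N : R) :
  ~ trivial_stabilizer M -> is_center M M ->
  exists t : posreal, N < t /\ Rbar_le (GH_dist (scale t M) M) (Finite 0).
Proof.
intros nontriv [_ fixed].
assert (ex : exists a : posreal, 1 < a /\ Rbar_le (GH_dist (scale a M) M) (Finite 0)).
(* Since 1 always stabilizes, nontriviality can only come from some l different from 1 in the
   stabilizer. *)
{ apply NNPP; intros no; apply nontriv; intros l; split; [| apply stabilizer_1].
  intros st; apply NNPP; intros ne; apply no.
  assert (h : Rbar_le (GH_dist (scale l M) M) (Finite 0))
    by (rewrite (fixed l st); apply Rbar_le_refl).
  destruct (Rlt_or_le 1 l) as [lt | le]; [exists l; auto |].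
  exists (posreal_inv l); split; [| apply GH_fixed_inv, h].
  pose proof (cond_pos l); simpl.
  rewrite <- Rinv_1; apply Rinv_lt_contravar; lra. }
destruct ex as [a [a_gt h]].
(* The divergence of powers yields a weak inequality; N + 1 makes it strict. *)
destruct (Pow_x_infinity a) with (b := N + 1) as [n hn].
{ rewrite Rabs_pos_eq; lra. }
destruct (GH_fixed_pow M a n h) as [t [e ht]]; exists t; split; [| exact ht].
specialize (hn n (le_n n)); rewrite <- e, Rabs_pos_eq in hn; [lra |].
apply Rlt_le, cond_pos.
Qed.

(** * Transport of distances between the two clouds and the final estimate *)

Lemma distortion_bound (Rel : MetSpace -> MetSpace -> Prop) (eps : R)
  (A A' B B' : MetSpace) :
  distortion Rel = Finite eps -> Rel A B -> Rel A' B' ->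
  GH_dist A A' = Finite (GH_real A A') -> GH_dist B B' = Finite (GH_real B B') ->
  Rabs (GH_real A A' - GH_real B B') <= eps.
Proof.
intros dis rAB rAB' eA eB.
assert (h : Rbar_le (Rbar_abs (Rbar_minus (GH_dist A A') (GH_dist B B'))) (distortion Rel)).
{ apply Rbar_lub_correct; exists A, A', B, B'; auto. }
rewrite dis, eA, eB in h; exact h.
Qed.

Theorem theorem2 (M : MetSpace)
  (M_stab : ~ trivial_stabilizer M)
  (M_center : is_center M M)
  (Rel : MetSpace -> MetSpace -> Prop)
  (Rel_corr : correspondence Delta1 M Rel)
  (eps : R) (Rel_dis : distortion Rel = Finite eps) :
  forall Y : MetSpace, Rel Delta1 Y ->
    Rbar_le (GH_dist Y M) (Finite (2 * eps)).
Proof.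
intros Y rY.
destruct Rel_corr as [in_cloud _ total surj].
destruct (in_cloud _ _ rY) as [cD cY]; pose proof (proj1 M_center) as cM.
assert (transport : forall A A' B B', Rel A B -> Rel A' B' ->
  - eps <= GH_real A A' - GH_real B B' <= eps).
{ intros A A' B B' h h'; apply Rabs_le_iff.
  destruct (in_cloud _ _ h), (in_cloud _ _ h').
  apply (distortion_bound Rel eps A A' B B' Rel_dis h h'); eapply cloud_finite; eauto. }
rewrite (cloud_finite M Y M cY cM); simpl.
set (d := GH_real Y M).
assert (d_pos : 0 <= d).
{ pose proof (GH_dist_pos Y M) as h; rewrite (cloud_finite M Y M cY cM) in h; exact h. }
assert (eps_pos : 0 <= eps) by (pose proof (transport _ _ _ _ rY rY); lra).
apply Rnot_lt_le; intros lt.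
(* The argument ends in t (d - 2 eps) <= 4 d + 5 eps, and t is chosen to violate this. The right
   side collects 3 d + 3 eps lost in bounding |B, M| below by about 2 t d, and d + 2 eps lost in
   bounding |B, t Y| above by about t d. *)
destruct (center_fixed_large M ((4 * d + 5 * eps) / (d - 2 * eps)) M_stab M_center)
  as [t [t_gt fixed]].
assert (t_big : 4 * d + 5 * eps < t * (d - 2 * eps)).
{ apply (Rmult_lt_compat_r (d - 2 * eps)) in t_gt; [| lra].
  replace ((4 * d + 5 * eps) / (d - 2 * eps) * (d - 2 * eps)) with (4 * d + 5 * eps)
    in t_gt by (field; lra); exact t_gt. }
pose proof (cond_pos t) as t_pos.
destruct (GH_real_scale_fixed t M Y cY fixed) as [ctY dtY]; fold d in dtY.
(* Pull t Y back to a bounded space A, double it, and push 2 A forward to B. Then |B, Y| is about 2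
   |t Y, Y|, while |B, t Y| is at most about |t Y, Y|. *)
destruct (surj _ ctY) as [A rA].
set (two := mkposreal 2 Rlt_0_2).
destruct (in_cloud _ _ rA) as [cA _].
destruct (GH_real_scale_fixed two Delta1 A cA (GH_dist_scale_Delta1 two)) as [c2A d2A].
change (pos two) with 2 in d2A.
destruct (total _ c2A) as [B rB]; destruct (in_cloud _ _ rB) as [_ cB].
assert (d2AA : GH_real (scale two A) A <= GH_real A Delta1).
{ apply GH_real_le, GH_dist_scale_2_bounded; [reflexivity |].
  rewrite (cloud_finite Delta1 A Delta1 cA cD); apply Rbar_le_refl. }
pose proof (transport _ _ _ _ rA rY) as tA.
pose proof (transport _ _ _ _ rB rY) as tB.
pose proof (transport _ _ _ _ rB rA) as tBA.
pose proof (GH_real_tri M _ _ _ ctY cY cM) as tri1; fold d in tri1.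
pose proof (GH_real_tri M _ _ _ ctY cM cY) as tri2.
rewrite (GH_real_sym M Y) in tri2; fold d in tri2.
pose proof (GH_real_tri M _ _ _ cB cM cY) as tri3.
rewrite (GH_real_sym M Y) in tri3; fold d in tri3.
(* Shrinking B by 1/t divides the additive errors by t and keeps M in place. *)
destruct (GH_real_scale_fixed (posreal_inv t) M B cB (GH_fixed_inv M t fixed)) as [cB' dB'].
set (B' := scale (posreal_inv t) B) in *.
assert (dB'M : t * GH_real B' M = GH_real B M)
  by (rewrite dB'; simpl; field; lra).
(* Compare B' with (1/t)(t Y), which is at distance zero from Y; this zero is the summand 0
   below. *)
assert (dB'Y : t * GH_real B' Y <= GH_real B (scale t Y)).
{ replace (GH_real B (scale t Y)) with (t * (posreal_inv t * GH_real B (scale t Y) + 0))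
    by (simpl; field; lra).
  apply Rmult_le_compat_l; [lra |]; apply GH_real_le.
  apply GH_dist_tri with (scale (posreal_inv t) (scale t Y)).
  - apply GH_dist_scale_le; rewrite (cloud_finite M _ _ cB ctY); apply Rbar_le_refl.
  - rewrite GH_dist_sym; apply GH_dist_scale_inv. }
destruct (surj _ cM) as [C rC]; destruct (surj _ cB') as [C' rC'].
pose proof (proj1 (in_cloud _ _ rC)) as cC; pose proof (proj1 (in_cloud _ _ rC')) as cC'.
assert (ultra : GH_real C' C <= Rmax (GH_real C' Delta1) (GH_real C Delta1)).
{ apply GH_real_le, GH_dist_bounded_max.
  - rewrite (cloud_finite Delta1 C' Delta1 cC' cD); apply Rmax_l.
  - rewrite (cloud_finite Delta1 C Delta1 cC cD); apply Rmax_r. }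
pose proof (transport _ _ _ _ rC' rC) as tCC'.
pose proof (transport _ _ _ _ rC rY) as tC; rewrite (GH_real_sym M Y) in tC; fold d in tC.
pose proof (transport _ _ _ _ rC' rY) as tC'.
(* One eps is spent on passing from |B', M| to |C', C|, the other on returning from the distances to
   [Delta1] to the distances to Y. *)
assert (B'M : GH_real B' M <= Rmax (GH_real B' Y) d + 2 * eps).
{ revert ultra; unfold Rmax; repeat destruct Rle_dec; lra. }
assert (h : t * GH_real B' M <= t * (Rmax (GH_real B' Y) d + 2 * eps))
  by (apply Rmult_le_compat_l; lra).
(* The left side is at least 2 t d - 3 d - 3 eps, and the right side at most t d + d + 2 eps + 2 t
   eps, against [t_big]. *)
revert h; unfold Rmax; destruct Rle_dec; lra.
Qed.
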